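(* Let $u_L:[m]\times[n]\to[-1,1]$ be a learner payoff satisfying the standing assumptions, and let $(i^*,j^* )$ be the unique pair maximizing $u_L$ over $[m]\times[n]$. Let $\mathcal{M}$ be the asymptotic menu $\mathcal{M}=\{x\otimes j^*\mid x\in\Delta_m\}$. Then $\mathcal{M}$ is Pareto-optimal.
   Context: The optimizer has action set $[m]$ and the learner has action set $[n]$. $\Delta_k$ is the simplex over $[k]$; $\Delta_{mn}$ is the set of probability distributions over $[m]\times[n]$. $x\otimes y$ is the product distribution (a pure action $j$ is identified with the point mass on $j$). Payoffs $u_L,u_O:[m]\times[n]\to[-1,1]$ are extended (multi)linearly to $\Delta_m\times\Delta_n$ and to $\Delta_{mn}$. $\mathrm{BR}_L(x)=\arg\max_{j\in[n]}u_L(x,j)$. Standing assumptions on $u_L$: (1) there is a unique pair $(i^*,j^* )\in[m]\times[n]$ maximizing $u_L$; (2) the learner has no weakly dominated action, i.e. every $j\in[n]$ for which some $x\in\Delta_m$ has $j\in\mathrm{BR}_L(x)$ also admits some $x'\in\Delta_m$ with $\mathrm{BR}_L(x')=\{j\}$. Asymptotic menus. A learning algorithm $\mathcal{A}=\{A^T\}_{T\in\mathbb{N}}$ consists, for each horizon $T$, of functions $A^T_t:\Delta_m^{t-1}\to\Delta_n$; against $(x_1,\dots,x_T)\in\Delta_m^T$ the learner plays $y_t=A^T_t(x_1,\dots,x_{t-1})$. $\mathcal{M}(A^T)$ is the convex hull of all points $\frac1T\sum_{t=1}^T x_t\otimes y_t$ over all optimizer sequences. If $\mathcal{M}(A^1),\mathcal{M}(A^2),\dots$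 converges in the Hausdorff metric, the (closed) limit is the asymptotic menu of $\mathcal{A}$. A subset of $\Delta_{mn}$ is an asymptotic menu if it arises this way from some learning algorithm. Pareto-optimality. For an asymptotic menu $\mathcal{M}$ and optimizer payoff $u_O$, $V_L(\mathcal{M},u_O)=\max\{u_L(\varphi)\mid\varphi\in\arg\max_{\varphi\in\mathcal{M}}u_O(\varphi)\}$. An asymptotic menu $\mathcal{M}'$ Pareto-dominates $\mathcal{M}$ if $V_L(\mathcal{M}',u_O)\ge V_L(\mathcal{M},u_O)$ for all $u_O:[m]\times[n]\to[-1,1]$, with strict inequality for at least one $u_O$. An asymptotic menu is Pareto-optimal if no asymptotic menu Pareto-dominates it. *)

(* Defs.v *)
From HB Require Import structures.
From mathcomp Require Export all_boot all_order all_algebra.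
From mathcomp Require Export all_classical all_reals all_analysis.
Export Order.TTheory GRing.Theory Num.Theory.
Export numFieldNormedType.Exports.

Set Implicit Arguments.
Unset Strict Implicit.
Unset Printing Implicit Defensive.

Global Open Scope classical_set_scope.
Global Open Scope ring_scope.

Definition argmax (R : realType) (T : Type) (A : set T) (f : T -> R) : set T :=
  [set a | A a /\ forall b, A b -> f b <= f a].

Definition simplex (R : realType) (k : nat) : set 'rV[R]_k :=
  [set x | (forall i, 0 <= x 0 i) /\ \sum_i x 0 i = 1].

(* Distributions over [m] x [n]; the entry (i, j) is the mass of (i, j). *)
Definition joint_simplex (R : realType) (m n : nat) : set 'M[R]_(m, n) :=
  [set phi | (forall i j, 0 <= phi i j) /\ \sum_i \sum_j phi i j = 1].

Definition pure (R : realType) (k : nat) (j : 'I_k) : 'rV[R]_k := delta_mx 0 j.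

Definition tensor (R : realType) (m n : nat) (x : 'rV[R]_m) (y : 'rV[R]_n) :
  'M[R]_(m, n) := \matrix_(i, j) (x 0 i * y 0 j).

Definition payoff (R : realType) (m n : nat) : Type := 'I_m -> 'I_n -> R.

Definition bounded_payoff (R : realType) (m n : nat) (u : payoff R m n) : Prop :=
  forall i j, -1 <= u i j <= 1.

Definition expected (R : realType) (m n : nat) (u : payoff R m n)
    (phi : 'M[R]_(m, n)) : R :=
  \sum_i \sum_j phi i j * u i j.

Definition best_response (R : realType) (m n : nat) (uL : payoff R m n)
    (x : 'rV[R]_m) : set 'I_n :=
  argmax setT (fun j => expected uL (tensor x (pure R j))).

Definition unique_maximizer (R : realType) (m n : nat) (u : payoff R m n)
    (istar : 'I_m) (jstar : 'I_n) : Prop :=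
  argmax setT (fun p => u p.1 p.2) = [set (istar, jstar)].

Definition no_weakly_dominated (R : realType) (m n : nat)
    (uL : payoff R m n) : Prop :=
  forall j : 'I_n,
    (exists2 x, simplex x & best_response uL x j) ->
    exists2 x, simplex x & best_response uL x = [set j].

(* [play T h] is the learner's mixed action A^T_t(h) at round t = size h + 1;
   its values on histories of length at least T are irrelevant. *)
Record learning_algorithm (R : realType) (m n : nat) := LearningAlgorithm {
  play :> nat -> seq 'rV[R]_m -> 'rV[R]_n;
  play_simplex : forall (T : nat) (h : seq 'rV[R]_m), (size h < T)%N ->
    (forall x, x \in h -> simplex x) -> simplex (play T h)
}.

Definition outcome (R : realType) (m n T : nat) (A : learning_algorithm R m n)
    (x : T.-tuple 'rV[R]_m) : 'M[R]_(m, n) :=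
  T%:R^-1 *: \sum_(t < T) tensor (tnth x t) (A T (take t x)).

Definition convex_hull (R : realType) (E : lmodType R) (S : set E) : set E :=
  smallest (@convex_set R E) S.

Definition menu (R : realType) (m n : nat) (A : learning_algorithm R m n)
    (T : nat) : set 'M[R]_(m, n) :=
  convex_hull [set outcome A x | x in
    [set x : T.-tuple 'rV[R]_m | forall t, simplex (tnth x t)]].

(* The library's distance on matrices is the entrywise sup distance. *)
Definition hausdorff_edist (R : realType) (X : pseudoMetricType R)
    (A B : set X) : \bar R :=
  maxe (ereal_sup [set edist_inf B a | a in A])
       (ereal_sup [set edist_inf A b | b in B]).

Definition asymptotic_menu_of (R : realType) (m n : nat)
    (A : learning_algorithm R m n) (M : set 'M[R]_(m, n)) : Prop :=
  closed M /\ hausdorff_edist (menu A T) M @[T --> \oo] --> 0%E.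

Definition asymptotic_menu (R : realType) (m n : nat)
    (M : set 'M[R]_(m, n)) : Prop :=
  M `<=` @joint_simplex R m n /\
  exists A : learning_algorithm R m n, asymptotic_menu_of A M.

(* Asymptotic menus are nonempty and compact, so on them this sup is attained. *)
Definition learner_value (R : realType) (m n : nat) (uL : payoff R m n)
    (M : set 'M[R]_(m, n)) (uO : payoff R m n) : R :=
  sup [set expected uL phi | phi in argmax M (expected uO)].

Definition pareto_dominates (R : realType) (m n : nat) (uL : payoff R m n)
    (M' M : set 'M[R]_(m, n)) : Prop :=
  (forall uO, bounded_payoff uO ->
     learner_value uL M uO <= learner_value uL M' uO) /\
  (exists2 uO, bounded_payoff uO &
     learner_value uL M uO < learner_value uL M' uO).

Definition pareto_optimal (R : realType) (m n : nat) (uL : payoff R m n)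
    (M : set 'M[R]_(m, n)) : Prop :=
  asymptotic_menu M /\
  forall M', asymptotic_menu M' -> ~ pareto_dominates uL M' M.

(* Main.v *)
(* A single optimizer payoff decides everything: [uO(i, j) = 1] if [j <> jstar]
   and [0] otherwise. It vanishes on [M], so against it [M] gives the learner
   the global maximum [uL(istar, jstar)]. If [M'] dominates [M], then the point
   mass at [(istar, jstar)] must lie in [M'] and maximize [uO] there; hence
   [uO] vanishes on [M'], that is, [M'] is contained in [M]. Conversely, an
   optimizer repeating [x] forces a point of [M'] near some [tensor x y], and
   inside [M] this point can only be near [tensor x jstar]. So [M' = M], which
   rules out strict domination. *)
Require Import Defs.

Set Implicit Arguments.
Unset Strict Implicit.
Unset Printing Implicit Defensive.

(** * Compactness of the joint simplex and attainment of maxima *)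

Lemma sum_continuous (T : topologicalType) (R : realType) (I : finType)
    (f : I -> T -> R) :
  (forall i, continuous (f i)) -> continuous (fun x => \sum_i f i x).
Proof.
move=> cf x.
apply: (@cvg_big _ _ _ 0 xpredT (@add_continuous R) _ (nbhs x) _ f (f ^~ x)).
by move=> i _; exact: cf.
Qed.

Section Topology.
Variables (R : realType) (m n : nat).
Implicit Types (phi psi : 'M[R]_(m, n)) (A : set 'M[R]_(m, n)).

Lemma mx_ballE phi (e : R) psi : 0 < e ->
  ball phi e psi <-> forall i j, `|phi i j - psi i j| < e.
Proof. by move=> e0; split=> [[_ +]|]. Qed.

Lemma vec_mx_continuous : continuous (@vec_mx R m n).
Proof.
move=> u U /nbhs_ballP[e /= e0 eU]; apply/nbhs_ballP; exists e => // v [_ uv].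
by apply: eU; split=> // i j; rewrite !mxE.
Qed.

(** Flattening a matrix into a row vector reduces this to compactness of a finite product of copies
    of [K], carried back by the continuous map [vec_mx]. *)
Lemma mx_compact (K : set R) :
  compact K -> compact [set phi : 'M[R]_(m, n) | forall i j, K (phi i j)].
Proof.
move=> cK.
have -> : [set phi : 'M[R]_(m, n) | forall i j, K (phi i j)] =
    [set vec_mx u | u in [set u : 'rV[R]_(m * n) | forall k, K (u 0 k)]].
  apply/seteqP; split=> [phi Kphi|_ [u Ku <-] i j]; last by rewrite mxE.
  exists (mxvec phi); last by rewrite mxvecK.
  by move=> /= k; case/mxvec_indexP: k => i j; rewrite mxvecE.
apply: continuous_compact; last exact: (@rV_compact _ _ (fun=> K)).
exact/continuous_subspaceT/vec_mx_continuous.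
Qed.

Lemma expected_continuous (u : payoff R m n) : continuous (expected u).
Proof.
apply: sum_continuous => i; apply: sum_continuous => j phi.
apply: (@cvgM _ _ (nbhs phi) _ (fun psi : 'M[R]_(m, n) => psi i j)).
  exact: coord_continuous.
exact: cvg_cst.
Qed.

Lemma closed_joint_simplex : closed (@joint_simplex R m n).
Proof.
have -> : @joint_simplex R m n =
    \bigcap_(p in [set: 'I_m * 'I_n])
      (fun phi => phi p.1 p.2) @^-1` [set r | 0 <= r] `&`
    expected (fun _ _ => 1) @^-1` [set r | r = 1].
  have sumE phi : expected (fun _ _ => 1) phi = \sum_i \sum_j phi i j.
    by apply: eq_bigr => i _; apply: eq_bigr => j _; rewrite mulr1.
  apply/seteqP; split=> phi [phi0 phi1]; split.
  - by move=> p _; exact: phi0.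
  - by rewrite /= sumE.
  - by move=> i j; exact: (phi0 (i, j)).
  - by rewrite /= sumE in phi1.
apply: closedI.
  apply: closed_bigI => p _; apply: preimage_closed; last exact: closed_ge.
  by move=> phi _; exact: coord_continuous.
apply: preimage_closed; last exact: closed_eq.
by move=> phi _; exact: expected_continuous.
Qed.

Lemma joint_simplex_le1 phi i j : joint_simplex phi -> phi i j <= 1.
Proof.
move=> [phi0 <-]; rewrite (bigD1 i)//= (bigD1 j)//= -addrA lerDl.
by rewrite addr_ge0// ?sumr_ge0// => k _; rewrite sumr_ge0.
Qed.

Lemma compact_joint_simplex A :
  closed A -> A `<=` @joint_simplex R m n -> compact A.
Proof.
move=> clA sA.
apply: (subclosed_compact clA (@mx_compact _ (@segment_compact R 0 1))).
move=> phi /sA sphi i j /=; rewrite in_itv/= joint_simplex_le1// andbT.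
by case: sphi.
Qed.

End Topology.

(** The maximizers form the superlevel set of [f] at its maximum. Since this set is closed again, a
    second function can then be maximized over it, as the learner's tie-breaking requires. *)
Lemma compact_argmax (R : realType) (T : topologicalType) (A : set T)
    (f : T -> R) :
  A !=set0 -> compact A -> closed A -> continuous f ->
  argmax A f !=set0 /\ closed (argmax A f).
Proof.
move=> A0 cA clA cf.
have [|c /set_mem Ac cmax] := @compact_EVT_max T R f A A0 cA.
  exact: continuous_subspaceT.
have {}cmax b : A b -> f b <= f c by move=> Ab; apply: cmax; exact: mem_set.
split; first by exists c.
have -> : argmax A f = A `&` f @^-1` [set r | f c <= r].
  apply/seteqP; split=> a [Aa fa]; split=> //; first exact: fa.
  by move=> b Ab; rewrite (le_trans (cmax _ Ab)).
apply: closedI => //; apply: preimage_closed; last exact: closed_ge.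
by move=> ? _; exact: cf.
Qed.

Lemma learner_value_attained (R : realType) (m n : nat) (uL uO : payoff R m n)
    (A : set 'M[R]_(m, n)) :
  A !=set0 -> closed A -> A `<=` @joint_simplex R m n ->
  exists2 phi, argmax (argmax A (expected uO)) (expected uL) phi &
    learner_value uL A uO = expected uL phi.
Proof.
move=> A0 clA sA.
have [B0 clB] := compact_argmax A0 (compact_joint_simplex clA sA) clA
  (@expected_continuous R m n uO).
have sB : argmax A (expected uO) `<=` @joint_simplex R m n by move=> x [/sA].
have [[phi [Bphi phimax]] _] := compact_argmax B0 (compact_joint_simplex clB sB)
  clB (@expected_continuous R m n uL).
exists phi => //; apply/eqP; rewrite eq_le; apply/andP; split.
  apply: ge_sup; first by exists (expected uL phi), phi.
  by move=> _ [psi Bpsi <-]; exact: phimax.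
(* A real [sup] is meaningful only for a nonempty set that is bounded above; [phi] witnesses
   both. *)
apply: sup_upper_bound; last by exists phi.
split; first by exists (expected uL phi), phi.
by exists (expected uL phi) => _ [psi Bpsi <-]; exact: phimax.
Qed.

(** * Product distributions, and the outcomes of constant play *)

Section Outcomes.
Variables (R : realType) (m n : nat).
Implicit Types (x : 'rV[R]_m) (y : 'rV[R]_n) (phi : 'M[R]_(m, n)).

Lemma simplex_mean (k T : nat) (z : 'I_T -> 'rV[R]_k) : (0 < T)%N ->
  (forall t, simplex (z t)) -> simplex (T%:R^-1 *: \sum_t z t).
Proof.
move=> T0 sz; split=> [i|].
  rewrite mxE mulr_ge0 ?invr_ge0// summxE sumr_ge0// => t _.
  by case: (sz t).
under eq_bigr => i _ do rewrite mxE summxE.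
rewrite -mulr_sumr exchange_big /=.
under eq_bigr => t _ do rewrite (sz t).2.
by rewrite sumr_const card_ord mulVf// pnatr_eq0 -lt0n.
Qed.

Lemma simplex_pure (k : nat) (j : 'I_k) : simplex (pure R j).
Proof.
split=> [i|]; first by rewrite mxE.
rewrite (bigD1 j)//= mxE !eqxx big1 ?addr0// => i /negPf ij.
by rewrite mxE ij andbF.
Qed.

Lemma tensor_pureE x (j : 'I_n) i k :
  tensor x (pure R j) i k = x 0 i * (k == j)%:R.
Proof. by rewrite !mxE. Qed.

Lemma expected_pure (u : payoff R m n) i j :
  expected u (tensor (pure R i) (pure R j)) = u i j.
Proof.
rewrite /expected (bigD1 i)//= (bigD1 j)//= !big1 ?addr0.
- by rewrite !mxE !eqxx !mul1r.
- move=> k /negPf ki; apply: big1 => l _.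
  by rewrite !mxE ki andbF !mul0r.
- by move=> l /negPf lj; rewrite tensor_pureE lj mulr0 mul0r.
Qed.

Lemma row_sum_tensor x y i : simplex y -> \sum_j tensor x y i j = x 0 i.
Proof.
by move=> [_ y1]; under eq_bigr do rewrite mxE; rewrite -mulr_sumr y1 mulr1.
Qed.

Lemma joint_simplex_tensor x y :
  simplex x -> simplex y -> joint_simplex (tensor x y).
Proof.
move=> [x0 x1] sy; split=> [i j|]; first by rewrite mxE mulr_ge0//; case: sy.
by under eq_bigr => i _ do rewrite row_sum_tensor//.
Qed.

Lemma column_tensor phi (j : 'I_n) : joint_simplex phi ->
  (forall i k, k != j -> phi i k = 0) ->
  exists2 x, simplex x & tensor x (pure R j) = phi.
Proof.
move=> [phi0 phi1] supp.
exists (\row_i phi i j); last first.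
  apply/matrixP => i k; rewrite tensor_pureE mxE.
  by have [->|kj] := eqVneq k j; rewrite ?mulr1// mulr0 supp.
split=> [i|]; first by rewrite mxE.
rewrite -phi1; apply: eq_bigr => i _.
by rewrite mxE (bigD1 j)//= big1 ?addr0// => k; exact: supp.
Qed.

Variable A : learning_algorithm R m n.

(** Against a constant [x] the first tensor factor leaves the average, so [y] is the learner's mean
    action over the [T] rounds. *)
Lemma constant_play_outcome (T : nat) x : (0 < T)%N -> simplex x ->
  exists2 y, simplex y & menu A T (tensor x y).
Proof.
move=> T0 sx.
exists (T%:R^-1 *: \sum_(t < T) A T (take t (nseq_tuple T x))).
  apply: simplex_mean => // t; apply: play_simplex.
    by rewrite size_take size_tuple ltn_ord.
  by move=> z /mem_take; rewrite mem_nseq => /andP[_ /eqP ->].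
apply: sub_gen_smallest; exists (nseq_tuple T x).
  by move=> t; rewrite tnth_nseq.
rewrite /outcome; apply/matrixP => i j.
rewrite !mxE !summxE [RHS]mulrCA [x 0 i * _]mulr_sumr; congr (_ * _).
by apply: eq_bigr => t _; rewrite mxE tnth_nseq.
Qed.

Lemma constant_play_limit (M : set 'M[R]_(m, n)) x (e : R) : 0 < e ->
  asymptotic_menu_of A M -> simplex x ->
  exists2 y, simplex y & exists2 psi, M psi & ball (tensor x y) e psi.
Proof.
move=> e0 [_ cvgM] sx.
have [T [Te T0]] :
    exists T, (hausdorff_edist (menu A T) M < e%:E)%E /\ (0 < T)%N.
  (* Both conditions hold for all large [T], hence jointly for some [T]. *)
  apply: (@filter_ex _ \oo); apply: filterI; last exact: nbhs_infty_gt.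
  by apply: (cvgM [set z | (z < e%:E)%E]); apply: open_ereal_lt'.
have [y sy my] := constant_play_outcome T0 sx; exists y => //.
(* This half of the Hausdorff distance says that every point of the menu at horizon [T] is close to
   [M]. *)
move: Te; rewrite /hausdorff_edist gt_max => /andP[Te _].
have /ereal_inf_lt [_ [psi Mpsi <-] dpsi] : (edist_inf M (tensor x y) < e%:E)%E.
  by apply: le_lt_trans Te; apply: ereal_sup_ubound; exists (tensor x y).
by exists psi => //; exact: (edist_lt_ball dpsi).
Qed.

End Outcomes.

(** * The menu of a learner who always plays [jstar] *)

Section Commitment.
Variables (R : realType) (m n : nat) (jstar : 'I_n).

Notation commitment_menu :=
  [set tensor x (pure R jstar) | x in @simplex R m].

(** Describing the menu by its support turns membership into equations on single entries, from which
    closedness can be read off. *)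
Lemma commitment_menuE : commitment_menu =
  [set phi | joint_simplex phi /\ forall i j, j != jstar -> phi i j = 0].
Proof.
apply/seteqP; split=> [_ [x sx <-]|phi [sphi supp]].
  split; first by apply: joint_simplex_tensor => //; exact: simplex_pure.
  by move=> i j /negPf jj; rewrite tensor_pureE jj mulr0.
exact: column_tensor.
Qed.

Lemma closed_commitment_menu : closed commitment_menu.
Proof.
rewrite commitment_menuE.
have -> : [set phi : 'M[R]_(m, n) |
      joint_simplex phi /\ forall i j, j != jstar -> phi i j = 0] =
    @joint_simplex R m n `&` \bigcap_(p in [set p : 'I_m * 'I_n | p.2 != jstar])
      (fun phi : 'M[R]_(m, n) => phi p.1 p.2) @^-1` [set r | r = 0].
  apply/seteqP; split=> phi [sphi supp]; split=> //.
    by move=> p; exact: supp.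
  by move=> i j jj; exact: (supp (i, j)).
apply: closedI; first exact: closed_joint_simplex.
apply: closed_bigI => p _; apply: preimage_closed; last exact: closed_eq.
by move=> phi _; exact: coord_continuous.
Qed.

Lemma convex_commitment_menu :
  @convex_set R 'M[R]_(m, n) commitment_menu.
Proof.
move=> phi psi l /set_mem[x [x0 x1] <-] /set_mem[y [y0 y1] <-]; apply: mem_set.
exists (l%:num *: x + (1 - l%:num) *: y).
  split=> [i|].
    by rewrite !mxE addr_ge0// mulr_ge0// subr_ge0.
  under eq_bigr => i _ do rewrite !mxE.
  by rewrite big_split/= -!mulr_sumr x1 y1 !mulr1 subrKC.
by apply/matrixP => i j; rewrite !mxE mulrDl !mulrA.
Qed.

Definition commitment_algorithm : learning_algorithm R m n :=
  @LearningAlgorithm R m n (fun _ _ => pure R jstar)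
    (fun _ _ _ _ => simplex_pure R jstar).

(** With the second factor fixed, an outcome depends only on the mean of the optimizer's actions,
    and constant play reaches every mean. *)
Lemma menu_commitment T : (0 < T)%N ->
  menu commitment_algorithm T = commitment_menu.
Proof.
move=> T0; apply/seteqP; split.
  apply: smallest_sub; first exact: convex_commitment_menu.
  move=> _ [x sx <-]; exists (T%:R^-1 *: \sum_t tnth x t).
    exact: simplex_mean.
  apply/matrixP => i j; rewrite tensor_pureE !mxE !summxE -mulrA mulr_suml.
  by congr (_ * _); apply: eq_bigr => t _; rewrite tensor_pureE.
move=> _ [x sx <-]; apply: sub_gen_smallest; exists (nseq_tuple T x).
  by move=> t; rewrite tnth_nseq.
rewrite /outcome; under eq_bigr => t _ do rewrite tnth_nseq.
rewrite /= sumr_const card_ord -[tensor _ _ *+ _]scaler_nat scalerA.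
by rewrite mulVf ?scale1r// pnatr_eq0 -lt0n.
Qed.

(** For empty [A] both suprema would be -oo instead of 0. *)
Lemma hausdorff_edistxx (X : pseudoMetricType R) (A : set X) :
  A !=set0 -> hausdorff_edist A A = 0%E.
Proof.
move=> [a Aa]; rewrite /hausdorff_edist maxxx.
have -> : [set edist_inf A a | a in A] = [set 0%E].
  apply/seteqP; split=> [_ [b Ab <-]|_ ->]; first by rewrite edist_inf0.
  by exists a => //; rewrite edist_inf0.
exact: ereal_sup1.
Qed.

Lemma asymptotic_commitment_menu :
  (0 < m)%N -> asymptotic_menu commitment_menu.
Proof.
move=> m0; split.
  by rewrite commitment_menuE => phi [].
exists commitment_algorithm; split; first exact: closed_commitment_menu.
(* The sequence is constant only from [T = 1] on: at horizon 0 the sole outcome is the zero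
   matrix. *)
apply: cvg_near_cst; near=> T; rewrite menu_commitment; last first.
  by near: T; exact: nbhs_infty_gt.
apply: hausdorff_edistxx.
have sx := simplex_pure R (Ordinal m0).
by exists (tensor (pure R (Ordinal m0)) (pure R jstar)), (pure R (Ordinal m0)).
Unshelve. all: by end_near. Qed.

(* The point of [M] close to [tensor x y] has first marginal close to [x], and
   a distribution on the column [jstar] is determined by this marginal. *)
Lemma asymptotic_menu_commitment (M : set 'M[R]_(m, n)) :
  asymptotic_menu M -> M `<=` commitment_menu -> M = commitment_menu.
Proof.
move=> [_ [A AM]] sM; apply/seteqP; split=> // _ [x sx <-].
apply: AM.1.
rewrite closureEnbhs => B V MB /nbhs_ballP[e /= e0 eV].
have n0 : 0 < n%:R :> R by rewrite ltr0n (leq_trans _ (ltn_ord jstar)).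
(* The radius is [e / n] because a row sum adds up [n] entrywise errors. *)
have [y sy [psi Mpsi]] := constant_play_limit (divr_gt0 e0 n0) AM sx.
move=> /(mx_ballE _ _ (divr_gt0 e0 n0)) xypsi.
exists psi; split; first exact: MB.
apply: eV; apply/mx_ballE => // i j.
have [z sz zpsi] := sM _ Mpsi.
rewrite -zpsi !tensor_pureE -mulrBl.
have [_|_] := eqVneq j jstar; last by rewrite mulr0 normr0.
rewrite mulr1 -(row_sum_tensor x i sy).
rewrite -(row_sum_tensor z i (simplex_pure R jstar)) zpsi -sumrB.
rewrite (le_lt_trans (ler_norm_sum _ _ _))//.
rewrite (@lt_le_trans _ _ (\sum_(k < n) e / n%:R))//.
  (* Strictness survives summation because the index set contains [jstar]. *)
  by apply: ltr_sum => //; apply/hasP; exists jstar; rewrite ?mem_index_enum.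
by rewrite sumr_const card_ord -[_ / _ *+ _]mulr_natr divfK// gt_eqF.
Qed.

Definition off_column : payoff R m n := fun _ j => (j != jstar)%:R.

Lemma off_column_bounded : bounded_payoff off_column.
Proof.
by move=> i j; rewrite (le_trans (lerN10 _)) ?ler0n//= lern1 leq_b1.
Qed.

Lemma learner_value_commitment (uL : payoff R m n) (istar : 'I_m) :
  uL istar jstar <= learner_value uL commitment_menu off_column.
Proof.
pose phi := tensor (pure R istar) (pure R jstar).
have Mphi : commitment_menu phi.
  by exists (pure R istar) => //; exact: simplex_pure.
have col0 psi : commitment_menu psi -> expected off_column psi = 0.
  move=> [x _ <-]; apply: big1 => i _; apply: big1 => j _.
  by rewrite tensor_pureE /off_column; case: eqVneq; rewrite ?mulr0 ?mul0r.
have sM : commitment_menu `<=` @joint_simplex R m n.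
  by rewrite commitment_menuE => psi [].
have M0 : commitment_menu !=set0 by exists phi.
have [psi [_ psimax] ->] := learner_value_attained uL off_column M0
  (@closed_commitment_menu) sM.
(* The optimizer is indifferent on the whole menu, so the point mass [phi] competes in the learner's
   maximization. *)
rewrite -(expected_pure uL); apply: psimax; split=> // b Mb.
by rewrite !col0.
Qed.

End Commitment.

(** * Regret relative to the unique maximizer, and dominating menus *)

Section UniqueMaximizer.
Variables (R : realType) (m n : nat) (uL : payoff R m n).
Variables (istar : 'I_m) (jstar : 'I_n).
Hypothesis ustar : unique_maximizer uL istar jstar.

Lemma unique_maximizer_le i j : uL i j <= uL istar jstar.
Proof.
have [_ /(_ (i, j))] : argmax setT (fun p => uL p.1 p.2) (istar, jstar).
  by rewrite ustar.
exact.
Qed.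

Lemma unique_maximizer_lt i j :
  (i, j) != (istar, jstar) -> uL i j < uL istar jstar.
Proof.
move=> ij; rewrite lt_neqAle unique_maximizer_le andbT.
apply: contra_neq ij => uij.
suff: argmax setT (fun p => uL p.1 p.2) (i, j) by rewrite ustar.
by split=> // -[k l] _ /=; rewrite uij unique_maximizer_le.
Qed.

(** Writing the regret as a sum of nonnegative terms lets zero regret be read entry by entry. *)
Lemma expected_regret phi : joint_simplex phi ->
  uL istar jstar - expected uL phi =
  \sum_i \sum_j phi i j * (uL istar jstar - uL i j).
Proof.
move=> [_ phi1]; rewrite -[X in X - _]mul1r -phi1 mulr_suml -sumrB.
apply: eq_bigr => i _; rewrite mulr_suml -sumrB.
by apply: eq_bigr => j _; rewrite mulrBr.
Qed.

Lemma regret_ge0 phi i j : joint_simplex phi ->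
  0 <= phi i j * (uL istar jstar - uL i j).
Proof. by move=> [phi0 _]; rewrite mulr_ge0// subr_ge0 unique_maximizer_le. Qed.

Lemma expected_max_supp phi i j : joint_simplex phi ->
  uL istar jstar <= expected uL phi -> (i, j) != (istar, jstar) -> phi i j = 0.
Proof.
move=> sphi max ij.
have rows0 k : true -> 0 <= \sum_l phi k l * (uL istar jstar - uL k l).
  by move=> _; apply: sumr_ge0 => l _; exact: regret_ge0.
have /(psumr_eq0P rows0)/(_ i isT) :
    \sum_k \sum_l phi k l * (uL istar jstar - uL k l) = 0.
  apply/eqP; rewrite eq_le sumr_ge0// andbT -expected_regret//.
  by rewrite subr_le0.
move=> /psumr_eq0P /(_ j isT) /eqP.
rewrite mulf_eq0 subr_eq0 => /(_ (fun l _ => regret_ge0 i l sphi)).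
by move=> /orP[/eqP //|/eqP E]; have := unique_maximizer_lt ij; rewrite E ltxx.
Qed.

Lemma dominating_sub_commitment (M' : set 'M[R]_(m, n)) : asymptotic_menu M' ->
  uL istar jstar <= learner_value uL M' (off_column R jstar) ->
  M' `<=` [set tensor x (pure R jstar) | x in @simplex R m].
Proof.
move=> [sM' [A AM']] vM'.
(* Any mixed action and any radius would do here: the aim is a point of [M']. *)
have [_ _ [psi0 M'psi0 _]] :=
  constant_play_limit ltr01 AM' (simplex_pure R istar).
have M'0 : M' !=set0 by exists psi0.
have [phi [[M'phi phimax] _] vE] :=
  learner_value_attained uL (off_column R jstar) M'0 AM'.1 sM'.
rewrite vE in vM'.
(* [phi] has no regret, so its mass sits at [(istar, jstar)], where [off_column] is 0. *)
have phi0 : expected (off_column R jstar) phi = 0.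
  apply: big1 => i _; apply: big1 => j _; rewrite /off_column.
  have [_|jj] := eqVneq j jstar; first by rewrite mulr0.
  rewrite (expected_max_supp (sM' _ M'phi) vM') ?mul0r//.
  by apply: contra_neq jj => -[].
move=> psi M'psi; rewrite commitment_menuE; split; first exact: sM'.
have [psi_ge0 _] := sM' _ M'psi.
have term0 k l : 0 <= psi k l * off_column R jstar k l.
  by rewrite mulr_ge0// ler0n.
have rows0 k : true -> 0 <= \sum_l psi k l * off_column R jstar k l.
  by move=> _; apply: sumr_ge0 => l _.
(* The value is nonnegative, and at most that of the optimizer's best point [phi], which is 0. *)
have : expected (off_column R jstar) psi = 0.
  by apply/eqP; rewrite eq_le sumr_ge0// andbT -phi0 phimax.
move=> /(psumr_eq0P rows0) psi0' i j jj.
have /(psumr_eq0P (fun l _ => term0 i l))/(_ j isT) := psi0' i isT.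
by rewrite /off_column jj mulr1.
Qed.

End UniqueMaximizer.

Theorem theorem4p9 (R : realType) (m n : nat) (uL : payoff R m n)
    (istar : 'I_m) (jstar : 'I_n) :
  bounded_payoff uL ->
  unique_maximizer uL istar jstar ->
  no_weakly_dominated uL ->
  pareto_optimal uL
    [set tensor x (pure R jstar) | x in @simplex R m].
Proof.
move=> _ ustar _; split.
  exact/asymptotic_commitment_menu/(leq_trans _ (ltn_ord istar)).
move=> M' aM' [weak [uO _]].
have sM' := dominating_sub_commitment ustar aM'
  (le_trans (learner_value_commitment jstar uL istar)
    (weak _ (@off_column_bounded R m n jstar))).
(* Once the two menus coincide, the strict inequality at [uO] compares a number with itself. *)
by rewrite (asymptotic_menu_commitment aM' sM') ltxx.
Qed.
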